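(* Let $n\ge 0$ be an integer and let $Q_n$ be the $n$-th Yablonskii--Vorob'ev polynomial, written as $$Q_n=\sum_{s=0}^{\left[\frac{1}{6}n(n+1)\right]} a_s^n\, z^{\frac{1}{2}n(n+1)-3s},\qquad a_s^n\in\mathbb{Z},\quad a_0^n=1.$$ Then for every integer $m$ with $0\leq m\leq \left[\frac{1}{6}n(n+1)\right]$, we have $4^m\mid a_m^n$.
   Context: The Yablonskii--Vorob'ev polynomials $Q_n$ ($n\ge 0$) are defined by $Q_0=1$, $Q_1=z$ and the differential-difference equation $Q_{n+1}Q_{n-1}=zQ_n^2-4\left(Q_nQ_n''-(Q_n')^2\right)$ for $n\ge1$, where $'$ denotes $d/dz$. It is known that each $Q_n$ is a monic polynomial in $z$ of degree $\frac12 n(n+1)$ with integer coefficients, and (Taneda) that $Q_n\in\mathbb{Z}[z^3]$ if $n\not\equiv 1\pmod 3$ while $Q_n/z\in\mathbb{Z}[z^3]$ if $n\equiv 1\pmod 3$; hence the coefficients $a_s^n$ in the displayed expansion are well defined. The symbol $[\cdot]$ denotes the floor function. *)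

(* Defs.v *)
From mathcomp Require Import all_boot all_order all_algebra.

Set Implicit Arguments.
Unset Strict Implicit.
Unset Printing Implicit Defensive.

Import GRing.Theory.
Local Open Scope ring_scope.

(* The sequence of Yablonskii--Vorob'ev polynomials, given by its
   differential-difference equation over Z[z].  Z[z] is an integral domain and
   no term of the sequence vanishes, so at most one sequence satisfies this;
   its existence is the classical fact that the recurrence, a priori in Q(z),
   stays in Z[z]. *)
Definition yablonskii_vorobev (Q : nat -> {poly int}) : Prop :=
  [/\ Q 0%N = 1,
      Q 1%N = 'X
    & forall n : nat, (1 <= n)%N ->
        Q n.+1 * Q n.-1
          = 'X * Q n ^+ 2 - 4%:R * (Q n * (Q n)^`(2) - (Q n)^`() ^+ 2)].

(* Main.v *)
Require Import Defs.
From mathcomp Require Import all_boot all_order all_algebra all_field.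
From mathcomp Require Import ring zify.

Import GRing.Theory Num.Theory.
Local Open Scope ring_scope.

(** Let c be a cube root of 4. Rescaling by R_n(w) = c^(-n(n+1)/2) Q_n(c w) turns
    the factor 4 of the recurrence into 1:
      R_(n+1) R_(n-1) = w R_n^2 - (R_n R_n'' - R_n'^2).
    By induction each R_n is monic with integer coefficients, since the quotient
    of an integer polynomial by a monic integer polynomial, when exact over a
    larger field, is an integer polynomial. The coefficient of R_n in degree
    n(n+1)/2 - 3m is a_m / 4^m. *)

(** Euclidean division by the monic [B] works already over the integers. If [p] is the integer
    quotient, the image of the remainder is [q - p] times [B]; it is smaller than [B], which forces
    [q = p]. *)
Lemma int_quotient_by_monic (F : numFieldType) (A B : {poly int})
    (q : {poly F}) :
  B \is monic -> q * map_poly intr B = map_poly intr A ->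
  exists2 p : {poly int}, q = map_poly intr p & A = p * B.
Proof.
move=> monB qB.
have inj_map : injective (map_poly (intr : int -> F)).
  exact: (map_inj_poly (@intr_inj F)).
have monFB : map_poly (intr : int -> F) B \is monic by exact: monic_map.
pose p := Pdiv.Ring.rdivp A B.
have eA := Pdiv.RingMonic.rdivp_eq monB A.
have eq_p : q = map_poly intr p.
  apply/eqP; rewrite -subr_eq0; apply/eqP.
  have eqr : (q - map_poly intr p) * map_poly intr B
      = map_poly intr (Pdiv.Ring.rmodp A B).
    by rewrite mulrBl qB {1}eA rmorphD rmorphM /= addrC addKr.
  apply/eqP/negP => /negP nz.
  have: (size (map_poly intr (Pdiv.Ring.rmodp A B) : {poly F})
         < size (map_poly intr B : {poly F}))%N.
    by rewrite !(size_map_inj_poly (@intr_inj F)) // Pdiv.Ring.ltn_rmodpN0 ?monic_neq0.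
  rewrite -eqr size_Mmonic // ltnNge => /negP; apply.
  move: nz; rewrite -size_poly_gt0; case: (size (q - _)) => // k _.
  exact: leq_addl.
exists p => //; apply: inj_map.
by rewrite rmorphM /= -eq_p qB.
Qed.

Definition yv_rhs {K : comNzRingType} (p : {poly K}) : {poly K} :=
  'X * p ^+ 2 - (p * p^`(2) - p^`() ^+ 2).

(** The leading term comes from ['X * p ^+ 2], of size twice that of [p]; each product involving
    derivatives is strictly smaller. *)
Lemma yv_rhs_monic (K : idomainType) (p : {poly K}) :
  p \is monic -> yv_rhs p \is monic.
Proof.
move=> monp; have p0 := monic_neq0 monp.
have monX : 'X * p ^+ 2 \is monic by rewrite rpredM ?monicX ?rpredX.
have sp : (0 < size p)%N by rewrite size_poly_gt0.
have sd : (size p^`() < size p)%N by exact: lt_size_deriv.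
have sdd : (size p^`(2) < size p)%N.
  rewrite derivnS derivn1; have [->|d0] := eqVneq p^`() 0.
    by rewrite deriv0 size_poly0.
  exact: ltn_trans (lt_size_deriv d0) sd.
have lt_mul (q r : {poly K}) : (size q <= size p)%N -> (size r < size p)%N ->
    (size (q * r)%R < size p + size p)%N.
  by have := size_polyMleq q r; lia.
rewrite /yv_rhs monicE lead_coefDl -?monicE // size_polyN.
have -> : size ('X * p ^+ 2) = (size p + size p)%N.
  by rewrite mulrC size_mulX ?expf_neq0 // expr2 size_Mmonic //; lia.
apply: leq_ltn_trans (size_polyD _ _) _; rewrite size_polyN gtn_max.
apply/andP; split.
  exact: lt_mul.
by rewrite expr2; apply: lt_mul => //; exact: ltnW.
Qed.

Lemma monic_cofactor (A B : {poly int}) :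
  B \is monic -> A * B \is monic -> A \is monic.
Proof. by rewrite !monicE => /eqP lB; rewrite lead_coefM lB mulr1. Qed.

Section Rescaling.

Variable c : algC.
Hypothesis c3 : c ^+ 3 = 4%:R.

Definition rescale (P : {poly int}) : {poly algC} :=
  map_poly intr P \Po (c *: 'X).

Lemma coef_rescale (P : {poly int}) i : (rescale P)`_i = c ^+ i * (P`_i)%:~R.
Proof.
have expcX k : (c *: 'X : {poly algC}) ^+ k = c ^+ k *: 'X^k.
  by rewrite exprZn.
rewrite /rescale comp_polyE coef_sum mulrC.
under eq_bigr => k _ do rewrite coefZ expcX coefZ coefXn.
have [lt_i|ge_i] := ltnP i (size (map_poly intr P : {poly algC})).
  rewrite (bigD1 (Ordinal lt_i)) //= eqxx mulr1 coef_map big1 ?addr0 // => k.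
  by rewrite -val_eqE eq_sym /= => /negbTE ->; rewrite !mulr0.
rewrite big1 => [|k _].
  by rewrite -(coef_map intr) nth_default ?mul0r.
by rewrite gtn_eqF ?mulr0 // (leq_trans _ ge_i).
Qed.

(** Each term of the bracket carries two derivatives, so rescaling multiplies it by [c ^+ 2]. Since
    4 is [c ^+ 3], a single factor [c] remains in front of both terms. *)
Lemma rescale_recurrence (P Q Q' : {poly int}) :
  Q' * P = 'X * Q ^+ 2 - 4%:R * (Q * Q^`(2) - Q^`() ^+ 2) ->
  rescale Q' * rescale P =
    c *: ('X * rescale Q ^+ 2
          - (rescale Q * (rescale Q)^`(2) - (rescale Q)^`() ^+ 2)).
Proof.
have deriv_rescale P0 : (rescale P0)^`() = c%:P * rescale P0^`().
  by rewrite /rescale deriv_comp deriv_map derivZ derivX alg_polyC mulrC.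
have C3 : (4%:R : {poly algC}) = c%:P ^+ 3 by rewrite -rmorphXn c3 rmorph_nat.
move/(congr1 rescale).
have -> A B : rescale (A * B) = rescale A * rescale B.
  by rewrite /rescale !rmorphM.
move=> ->.
rewrite !derivnS derivn0 !deriv_rescale derivM derivC mul0r add0r.
rewrite deriv_rescale /rescale !(rmorphB, rmorphM, rmorphXn, rmorph_nat) /=.
rewrite map_polyX comp_polyX C3 -!mul_polyC; ring.
Qed.

Lemma c_neq0 : c != 0.
Proof. by apply: contra_eq_neq c3 => ->; rewrite expr0n /= eq_sym pnatr_eq0. Qed.

(** Monicity of [R] is part of the invariant because the recurrence later divides by it. *)
Definition integral_rescaling (d : nat) (P : {poly int}) : Prop :=
  exists2 R : {poly int}, R \is monic
    & rescale P = c ^+ d *: map_poly intr R.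

(** The condition on the exponents balances the powers of [c] on the two sides of the rescaled
    recurrence. *)
Lemma integral_rescaling_step (d e f : nat) (P Q Q' : {poly int}) :
  Q' * P = 'X * Q ^+ 2 - 4%:R * (Q * Q^`(2) - Q^`() ^+ 2) ->
  (f + d = e + e + 1)%N ->
  integral_rescaling d P -> integral_rescaling e Q -> integral_rescaling f Q'.
Proof.
move=> /rescale_recurrence rec hd [R monR eR] [S monS eS].
have cf0 : c ^+ f != 0 by rewrite expf_neq0 ?c_neq0.
have cd0 : c ^+ d != 0 by rewrite expf_neq0 ?c_neq0.
have eqR : (c ^- f *: rescale Q') * map_poly intr R
         = map_poly intr (yv_rhs S).
  (* Multiplying by [c ^+ f * c ^+ d] clears the inverse and restores the left side of [rec]. *)
  apply: (scalerI (mulf_neq0 cf0 cd0)).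
  rewrite -scalerAl scalerA mulrAC mulfV // mul1r scalerAr -eR rec eS.
  rewrite -exprD hd /yv_rhs !(rmorphB, rmorphM, rmorphXn) /= map_polyX.
  rewrite -!deriv_map !derivZ.
  rewrite -!mul_polyC !exprD expr1 !rmorphM /=; ring.
have [p ep eA] := int_quotient_by_monic _ _ _ _ monR eqR.
exists p; first by apply: monic_cofactor monR _; rewrite -eA yv_rhs_monic.
by rewrite -ep scalerA mulfV // scale1r.
Qed.

Lemma yv_integral_rescaling (Q : nat -> {poly int}) (n : nat) :
  yablonskii_vorobev Q -> integral_rescaling 'C(n.+1, 2) (Q n).
Proof.
case=> Q0 Q1 Qrec.
suff: integral_rescaling 'C(n.+1, 2) (Q n)
      /\ integral_rescaling 'C(n.+2, 2) (Q n.+1) by case.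
elim: n => [|n [IHn IHn1]].
  split.
    exists 1; first exact: monic1.
    by rewrite Q0 /rescale !rmorph1 bin_small // scale1r.
  exists 'X; first exact: monicX.
  by rewrite Q1 /rescale map_polyX comp_polyX binn expr1.
split=> //; apply: (integral_rescaling_step _ _ _ _ _ _ _ _ IHn IHn1).
  exact: (Qrec n.+1).
by rewrite !binS !bin0 !bin1; lia.
Qed.

End Rescaling.

Theorem lemma1 (Q : nat -> {poly int}) (hQ : yablonskii_vorobev Q)
    (n : nat) (a : nat -> int)
    (ha : Q n = \sum_(0 <= s < (n * (n + 1) %/ 6).+1)
                  a s *: 'X^(n * (n + 1) %/ 2 - 3 * s))
    (ha0 : a 0%N = 1)
    (m : nat) (hm : (m <= n * (n + 1) %/ 6)%N) :
  (4 ^+ m %| a m)%Z.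
Proof.
have c3 : (3.-root (4%:R : algC)) ^+ 3 = 4%:R by rewrite rootCK.
set c := 3.-root _ in c3.
have [R _ eR] := yv_integral_rescaling c c3 Q n hQ.
set d := 'C(n.+1, 2) in eR.
have ed : (n * (n + 1) %/ 2)%N = d by rewrite /d bin2 divn2 mulnC addn1.
(* No subtraction [d - 3 * s] is truncated, so distinct [s] give distinct exponents. *)
have dm s : (s <= n * (n + 1) %/ 6)%N -> (3 * s <= d)%N by lia.
have Qm : (Q n)`_(d - 3 * m) = a m.
  rewrite ha ed coef_sum big_mkord (bigD1 (Ordinal (hm : (m < _.+1)%N))) //=.
  rewrite coefZ coefXn eqxx mulr1 big1 ?addr0 // => i ne_im.
  rewrite coefZ coefXn; case: eqP => [e|]; last by rewrite mulr0.
  have := dm _ (ltn_ord i : (i <= _)%N); have := dm _ hm.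
  by move: ne_im; rewrite -val_eqE /=; lia.
have := congr1 (fun p : {poly algC} => p`_(d - 3 * m)) eR.
rewrite coef_rescale Qm coefZ coef_map /=.
(* Splitting [c ^+ d] as [c ^+ (d - 3 * m)] times [4 ^+ m] lets the first factor cancel; [a m] is
   then [4 ^+ m] times a coefficient of [R]. *)
rewrite -{2}(subnK (dm _ hm)) exprD -mulrA exprM c3.
move/(mulfI (expf_neq0 _ (c_neq0 c c3))).
have -> : (4%:R : algC) = (4%:~R) by [].
rewrite -rmorphXn -rmorphM => /intr_inj ->.
exact: dvdz_mulr.
Qed.
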